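(* Let $G$ be a transitive permutation group on a finite set $\Omega$, and let $\alpha\in\Omega$, with stabiliser $G_\alpha$. Then $G$ is pre-primitive if and only if every subgroup $H$ of $G$ containing $G_\alpha$ has the form $H=NG_\alpha$ for some normal subgroup $N$ of $G$.
   Context: A permutation group on $\Omega$ is a subgroup of $\mathrm{Sym}(\Omega)$. A partition of $\Omega$ is $G$-invariant if every $g\in G$ maps each part onto a part. The orbit partition of a subgroup $H\le G$ is the partition of $\Omega$ into $H$-orbits. A transitive permutation group $G$ on a finite set $\Omega$ is pre-primitive if every $G$-invariant partition of $\Omega$ is the orbit partition of some subgroup of $G$. *)

(* Defs.v *)
From mathcomp Require Import all_boot all_fingroup.

Set Implicit Arguments.
Unset Strict Implicit.
Unset Printing Implicit Defensive.

Local Open Scope group_scope.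

Definition invariant_partition (T : finType) (G : {group {perm T}})
    (P : {set {set T}}) : Prop :=
  partition P [set: T] /\ [acts G, on P | 'P^*].

Definition orbit_partition (T : finType) (H : {group {perm T}}) :
    {set {set T}} :=
  [set orbit 'P H x | x : T].

Definition pre_primitive (T : finType) (G : {group {perm T}}) : Prop :=
  [transitive G, on [set: T] | 'P] /\
  forall P : {set {set T}}, invariant_partition G P ->
    exists2 H : {group {perm T}}, H \subset G & P = orbit_partition H.

(* Main.v *)
Require Import Defs.
From mathcomp Require Import all_boot all_fingroup.

Set Implicit Arguments.
Unset Strict Implicit.
Unset Printing Implicit Defensive.

Local Open Scope group_scope.

(** The subgroups between the point stabiliser [C = 'C_G[alpha | 'P]] and [G]
    correspond to the [G]-invariant partitions: [H] gives the translates under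
    [G] of the block [orbit 'P H alpha], and a partition gives the stabiliser
    in [G] of its part through [alpha].  The theorem says that, under this
    correspondence, a partition is an orbit partition exactly when the subgroup
    is [N * C] with [N] normal.  Three facts carry this.

    - A subgroup whose orbits are the parts of an invariant partition may be
      taken normal: the kernel of the action of [G] on the parts contains it
      and, moving no part, has the same orbits
      ([orbit_partition_normal]).
    - The orbits of a normal subgroup [N] are permuted by the transitive group
      [G], as are the parts of an invariant partition, so the orbits of [N]
      are the parts as soon as the orbit of [alpha] is a part
      ([orbit_partition_of_block]).
    - For [N] normal, the equality [H = N * C] just says that [N] and [H] have
      the same orbit through [alpha]: the factorisation is read off from which
      elements send [alpha] to the same point ([orbit_eq_mul_stab]). *)

Section Blocks.

Variables (aT : finGroupType) (T : finType) (to : {action aT &-> T}).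
Implicit Types (G H N : {group aT}) (P : {set {set T}}) (x y : T).

(** Two elements of [G] sending [x] to the same point differ by an element of
    the stabiliser, so equality of the orbits of [x] transfers membership
    between [N], [H] and the stabiliser.  Normality makes the products in
    either order agree. *)
Lemma orbit_eq_mul_stab G H N x :
    N <| G -> H \subset G -> 'C_G[x | to] \subset H ->
  orbit to N x = orbit to H x <-> H = N * 'C_G[x | to] :> {set aT}.
Proof.
case/andP=> sNG nNG sHG sCH.
have nNC : 'C_G[x | to] \subset 'N(N) := subset_trans sCH (subset_trans sHG nNG).
split=> [eqNH | defH]; last first.
  have sNH : N \subset H by rewrite defH mulG_subl.
  apply/eqP; rewrite eqEsubset imsetS //=; apply/subsetP=> _ /orbitP[h + <-].
  rewrite defH -normC // => /mulsgP[c n /setIP[_ /astab1P xc] Nn ->].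
  by rewrite actM xc mem_orbit.
have sNH : N \subset H.
  apply/subsetP=> n Nn.
  have /orbitP[h Hh eq_nh] : to x n \in orbit to H x by rewrite -eqNH mem_orbit.
  rewrite -(groupMr _ (groupVr Hh)) (subsetP sCH) // inE.
  rewrite groupM ?groupV ?(subsetP sNG n) ?(subsetP sHG h) //.
  by apply/astab1P; rewrite actM -eq_nh actK.
apply/eqP; rewrite eqEsubset mul_subG // andbT; apply/subsetP=> h Hh.
have /orbitP[n Nn eq_nh] : to x h \in orbit to N x by rewrite eqNH mem_orbit.
rewrite -normC // -(mulgKV n h) mem_mulg // inE.
rewrite groupM ?groupV ?(subsetP sNG n) ?(subsetP sHG h) //.
by apply/astab1P; rewrite actM -eq_nh actK.
Qed.

Lemma setact_orbit_normal G N x g :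
  N <| G -> g \in G -> to^*%act (orbit to N x) g = orbit to N (to x g).
Proof. by case/andP=> _ nNG Gg; rewrite /= setact_orbit (normsP nNG). Qed.

(** If two translates of the [H]-orbit meet, the group elements involved differ
    by an element of [H], because [H] contains the whole stabiliser of [x];
    hence the translates coincide. *)
Lemma orbit_translates_partition G H x :
    [transitive G, on [set: T] | to] -> H \subset G -> 'C_G[x | to] \subset H ->
  partition (orbit to^* G (orbit to H x)) [set: T].
Proof.
move=> trG sHG sCH; apply/and3P; split.
- rewrite -subTset; apply/subsetP=> y _.
  have [g Gg ->] := atransP2 trG (in_setT x) (in_setT y).
  apply/bigcupP; exists (to^*%act (orbit to H x) g); first exact: mem_orbit.
  by rewrite mem_setact ?orbit_refl.
- apply/trivIsetP=> _ _ /orbitP[a Ga <-] /orbitP[b Gb <-].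
  apply: contraR => /exists_inP[_ /imsetP[_ /orbitP[h Hh <-] ->]].
  case/imsetP=> _ /orbitP[k Hk <-] eq_hk.
  have Hhab : h * a * (k * b)^-1 \in H.
    have Gh := subsetP sHG h Hh; have Gk := subsetP sHG k Hk.
    apply/(subsetP sCH)/setIP; split; first by rewrite !(groupM, groupV).
    by apply/astab1P; rewrite !actM eq_hk -(actM to x k b) actK.
  have Hab : a * b^-1 \in H.
    by move: Hhab; rewrite invMg -!mulgA groupMl // mulgA groupMr ?groupV.
  have eqX : to^*%act (orbit to H x) (a * b^-1) = orbit to H x.
    exact: astabs_setact (subsetP (acts_orbit to x (subsetT H)) _ Hab).
  have := actM to^* (orbit to H x) (a * b^-1) b.
  by rewrite mulgKV /= eqX => ->.
apply/negP=> /orbitP[g _ eq0].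
by have := mem_setact to g (orbit_refl to H x); rewrite eq0 inE.
Qed.

Lemma setact_pblock G P x g :
    partition P [set: T] -> [acts G, on P | to^*] -> g \in G ->
  to^*%act (pblock P x) g = pblock P (to x g).
Proof.
case/and3P=> /eqP covP tiP _ actP Gg.
have xP : x \in cover P by rewrite covP.
apply/esym/def_pblock=> //; last by rewrite mem_setact ?mem_pblock.
by rewrite (acts_act actP) ?pblock_mem.
Qed.

Lemma partition_pblocks P :
  partition P [set: T] -> P = [set pblock P x | x : T].
Proof.
case/and3P=> /eqP covP tiP P0; apply/setP=> B; apply/idP/imsetP=> [PB | [x _ ->]].
  have /set0Pn[x Bx] : B != set0 by apply: contraNneq P0 => <-.
  by exists x; rewrite // (def_pblock tiP PB).
by rewrite pblock_mem ?covP.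
Qed.

End Blocks.

Section OrbitPartitions.

Variable T : finType.
Implicit Types (G H K N : {group {perm T}}) (P : {set {set T}}).

Lemma pblock_orbit_partition K x :
  pblock (Defs.orbit_partition K) x = orbit 'P K x.
Proof.
have /orbit_partition/and3P[_ tiK _] : [acts K, on [set: T] | 'P].
  by apply/actsP=> k _ y; rewrite !inE.
have -> : Defs.orbit_partition K = orbit 'P K @: [set: T].
  by apply/setP=> B; apply/imsetP/imsetP=> -[y _ ->]; exists y.
by apply: def_pblock; rewrite ?orbit_refl ?imset_f.
Qed.

(** The normal subgroup is the kernel of the action of [G] on the parts.  It
    contains [K], which preserves each of its own orbits, so its orbits are
    unions of parts; and it preserves each part, so its orbits are no
    larger. *)
Lemma orbit_partition_normal G K P :
    invariant_partition G P -> K \subset G -> P = Defs.orbit_partition K ->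
  exists2 N : {group {perm T}}, N <| G & P = Defs.orbit_partition N.
Proof.
case=> partP actP sKG defP; exists 'C_G(P | 'P^*)%G => /=.
  by rewrite /normal subsetIl normsI ?normG ?(subset_trans actP) ?astab_norm.
have sKN : K \subset 'C_G(P | 'P^*).
  rewrite subsetI sKG; apply/subsetP=> k Kk; apply/astabP=> B; rewrite defP => /imsetP[x _ ->].
  by rewrite /= setact_orbit conjGid // orbit_act.
rewrite {1}defP; apply: eq_imset => x; apply/eqP; rewrite eqEsubset imsetS //=.
apply/subsetP=> _ /orbitP[n /setIP[_ /astabP fixP] <-].
have PKx : orbit 'P K x \in P by rewrite defP imset_f.
by rewrite -(fixP _ PKx) mem_setact ?orbit_refl.
Qed.

(** Both [pblock P] and the orbit map of [N] commute with [G], so by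
    transitivity they agree everywhere if they agree at [x]. *)
Lemma orbit_partition_of_block G N P x :
    [transitive G, on [set: T] | 'P] -> invariant_partition G P -> N <| G ->
  pblock P x = orbit 'P N x -> P = Defs.orbit_partition N.
Proof.
move=> trG [partP actP] nNG eqx; rewrite (partition_pblocks partP).
apply: eq_imset => y; have [g Gg ->] := atransP2 trG (in_setT x) (in_setT y).
by rewrite -(setact_pblock _ partP actP Gg) eqx (setact_orbit_normal _ _ nNG).
Qed.

End OrbitPartitions.

Theorem theorem1p4 (T : finType) (G : {group {perm T}}) (alpha : T)
    (trG : [transitive G, on [set: T] | 'P]) :
  pre_primitive G <->
  (forall H : {group {perm T}}, H \subset G -> 'C_G[alpha | 'P] \subset H ->
     exists2 N : {group {perm T}}, N <| G & H = N * 'C_G[alpha | 'P] :> {set {perm T}}).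
Proof.
split=> [[_ preG] H sHG sCH | factG].
  pose P := orbit 'P^* G (orbit 'P H alpha).
  have invP : invariant_partition G P.
    split; first exact: orbit_translates_partition.
    exact: acts_orbit (subsetT _).
  have [K sKG defP] := preG P invP.
  have [N nNG defPN] := orbit_partition_normal invP sKG defP.
  exists N => //; apply/(orbit_eq_mul_stab nNG sHG sCH).
  have [partP _] := invP; have [_ tiP _] := and3P partP.
  rewrite -pblock_orbit_partition -defPN.
  by apply: def_pblock; rewrite ?orbit_refl.
split=> // P invP; have [partP actP] := invP.
pose B := pblock P alpha; pose H := 'N_G(B | 'P)%G.
have [/eqP covP tiP _] := and3P partP.
have Balpha : alpha \in B by rewrite mem_pblock covP.
have PB : B \in P by rewrite pblock_mem ?covP.
have sCH : 'C_G[alpha | 'P] \subset H.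
  apply/subsetP=> g /setIP[Gg /astab1P fix_g].
  apply/setIP; split=> //; rewrite /= -astab1_set.
  by apply/astab1P; rewrite (setact_pblock _ partP actP Gg) fix_g.
have [N nNG defH] := factG H (subsetIl _ _) sCH.
have [sNG _] := andP nNG; exists N => //.
apply: (orbit_partition_of_block trG invP nNG (x := alpha)).
have -> := (orbit_eq_mul_stab nNG (subsetIl _ _) sCH).2 defH.
(* An element of G carrying alpha into B carries B to a part meeting B. *)
apply/eqP; rewrite eqEsubset; apply/andP; split; last first.
  by rewrite acts_sub_orbit ?subsetIr.
apply/subsetP=> y By; have [g Gg def_y] := atransP2 trG (in_setT alpha) (in_setT y).
apply/orbitP; exists g => //; apply/setIP; split=> //; rewrite /= -astab1_set; apply/astab1P.
rewrite (setact_pblock _ partP actP Gg) -def_y; exact: def_pblock.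
Qed.
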